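(* Let $\mathbb{F}_q$ be a finite field with $q$ elements. Then: (i) For every $N\ge1$, every max-sequence of order $N$ over $\mathbb{F}_q$ is a modified de Bruijn sequence of order $N$ over $\mathbb{F}_q$. (ii) Consequently, for every $N\ge1$ there exists a de Bruijn sequence of order $N$ over $\mathbb{F}_q$. (iii) For every $N\ge1$, the number of pairwise non-equivalent de Bruijn sequences of order $N$ over $\mathbb{F}_q$ is at least the number of primitive polynomials of degree $N$ over $\mathbb{F}_q$.
   Context: A sequence $S=\{s_0,s_1,\dots\}$ over $\mathbb{F}_q$ is periodic with period $T\ge1$ if $s_{i+T}=s_i$ for all $i\ge0$. A monic polynomial $x^n+c_{n-1}x^{n-1}+\cdots+c_0\in\mathbb{F}_q[x]$ is a characteristic polynomial of $S$ if $s_{i+n}+c_{n-1}s_{i+n-1}+\cdots+c_0s_i=0$ for all $i=0,1,\dots$. The minimal polynomial of a periodic sequence is its (unique) characteristic polynomial of minimal degree. The order $\mathrm{ord}(f)$ of a polynomial $f\in\mathbb{F}_q[x]$ with $f(0)\neq0$ is the smallest positive integer $\ell$ such that $f$ divides $x^\ell-1$. A (monic) irreducible polynomial $f\in\mathbb{F}_q[x]$ with $f(0)\neq 0$ is primitive if $\mathrm{ord}(f)=q^{\deg(f)}-1$. A max-sequence of order $N$ is a periodic sequence over $\mathbb{F}_q$ whose minimal polynomial is primitive of degree $N$. A de Bruijn sequence of order $N$ over $\mathbb{F}_q$ is a $q^N$-periodic sequence $B=\{b_0,b_1,\dots\}$ such that $\{(b_i,b_{i+1},\dots,b_{i+N-1}):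 i=0,1,\dots,q^N-1\}=\mathbb{F}_q^N$. A modified de Bruijn sequence of order $N$ is a $(q^N-1)$-periodic sequence obtained from a de Bruijn sequence of order $N$ by removing, in each period, one zero from the unique occurrence of the all-zero $N$-tuple. Let $\mathbb{E}$ be the shift operator, $\mathbb{E}(\{s_0,s_1,\dots\})=\{s_1,s_2,\dots\}$. Two periodic sequences $S,T$ are equivalent if $\mathbb{E}^k(S)=T$ for some integer $k\geq 0$. *)

(* Defs.v *)
From mathcomp Require Import all_boot all_algebra qpoly qfpoly.
From mathcomp Require Import boolp classical_sets cardinality.

Set Implicit Arguments.
Unset Strict Implicit.
Unset Printing Implicit Defensive.

Import GRing.Theory.
Local Open Scope ring_scope.
Local Open Scope classical_set_scope.

(* A sequence over F is a function nat -> F. *)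

Definition periodic (T : Type) (p : nat) (s : nat -> T) : Prop :=
  (0 < p)%N /\ forall i, s (i + p)%N = s i.

Definition shift (T : Type) (s : nat -> T) : nat -> T := fun i => s i.+1.

Definition shift_equiv (T : Type) (s t : nat -> T) : Prop :=
  exists k, iter k (@shift T) s = t.

(* Only meant for periodic s, for which shift_equiv is symmetric: see
   shift_classP. *)
Definition shift_class (T : Type) (s : nat -> T) : set (nat -> T) :=
  [set t | shift_equiv s t].

Definition char_poly_of (F : fieldType) (f : {poly F}) (s : nat -> F) : Prop :=
  f \is monic /\ forall i, \sum_(j < size f) f`_j * s (i + j)%N = 0.

Definition min_poly_of (F : fieldType) (f : {poly F}) (s : nat -> F) : Prop :=
  char_poly_of f s /\
  forall g : {poly F}, char_poly_of g s -> (size f <= size g)%N.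

Definition poly_order (F : fieldType) (f : {poly F}) (l : nat) : Prop :=
  [/\ (0 < l)%N, f %| 'X^l - 1 &
      forall m, (0 < m)%N -> f %| 'X^m - 1 -> (l <= m)%N].

(* primitive_poly (qfpoly) is phrased with the cardinality of F[x]/(f); it is
   primitivity in terms of the order of f. *)
Lemma primitive_poly_order (F : finFieldType) (f : {poly F}) :
  primitive_poly f <->
  [/\ f \is monic, irreducible_poly f, f.[0] != 0 &
      poly_order f (#|F| ^ (size f).-1).-1].
Proof.
have card_f : monic_irreducible_poly f ->
    #|{poly %/ f}| = (#|F| ^ (size f).-1)%N.
  by move=> [fI fM]; rewrite card_monic_qpoly //; case: fI.
split=> [/primitive_polyP|[fM fI f0 [l0 fD fmin]]].
  set v := _.-1 => -[fMI fD fmin]; have [fI fM] := fMI.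
  have Ev : v = (#|F| ^ (size f).-1).-1 by rewrite /v card_f.
  have v_gt0 : (0 < v)%N.
    rewrite Ev -ltnS prednK ?expn_gt0 ?(ltnW (card_finNzRing_gt1 F)) //.
    rewrite -{1}(exp1n (size f).-1) ltn_exp2r ?card_finNzRing_gt1 //.
    by case: (size f) fI.1 => [|[]].
  split=> //; last first.
    rewrite -Ev; split=> // m m0 fm; rewrite leqNgt; apply/negP => mv.
    by have := fmin m; rewrite m0 mv fm => /(_ isT).
  apply/negP => /eqP f0; case/dvdpP: fD => g /(congr1 (horner^~ 0)).
  rewrite hornerM f0 mulr0 !hornerE expr0n eqn0Ngt v_gt0 sub0r => /eqP.
  by rewrite oppr_eq0 oner_eq0.
apply/primitive_polyP; rewrite card_f //; split=> // n /andP[n0 nv].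
by apply/negP => /(fmin n n0); rewrite leqNgt nv.
Qed.

Definition max_sequence (F : finFieldType) (N : nat) (s : nat -> F) : Prop :=
  (exists p, periodic p s) /\
  exists f : {poly F},
    [/\ min_poly_of f s, primitive_poly f & size f = N.+1].

Definition window (T : Type) (N : nat) (s : nat -> T) (i : nat) : N.-tuple T :=
  [tuple s (i + j)%N | j < N].

Definition de_bruijn (F : finFieldType) (N : nat) (b : nat -> F) : Prop :=
  periodic (#|F| ^ N) b /\
  [set window N b i | i in `I_(#|F| ^ N)] = [set: N.-tuple F].

(* The sequence left after deleting from s all entries whose index is r modulo
   L (for r < L and 1 < L): i |-> i %/ L.-1 * L + bump r (i %% L.-1) is the
   increasing enumeration of the other indices. *)
Definition delete_mod (T : Type) (L r : nat) (s : nat -> T) : nat -> T :=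
  fun i => s (i %/ L.-1 * L + bump r (i %% L.-1))%N.

(* p is the position of the all-zero N-tuple, and the entry deleted in each
   period is any one of its N zeros (the occurrence may straddle the end of the
   period, whence the reduction modulo #|F| ^ N). *)
Definition modified_de_bruijn (F : finFieldType) (N : nat) (m : nat -> F) :
    Prop :=
  periodic (#|F| ^ N).-1 m /\
  exists b : nat -> F, de_bruijn N b /\
  exists p j : nat,
    [/\ (p < #|F| ^ N)%N, window N b p = [tuple 0 | _ < N], (j < N)%N &
        m = delete_mod (#|F| ^ N) ((p + j) %% (#|F| ^ N)) b].

Lemma shift_classP (T : Type) (p : nat) (s t : nat -> T) : periodic p s ->
  shift_class s = shift_class t <-> shift_equiv s t.
Proof.
move=> [p0 ps].
have per k : iter (k * p) (@shift T) s = s.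
  have iterE n u i : iter n (@shift T) u i = u (i + n)%N.
    by elim: n i => [|n IH] i; rewrite ?addn0 //= /shift IH addSnnS.
  apply: funext => i; rewrite iterE.
  by elim: k => [|k IH]; rewrite ?addn0 // mulSn [(p + _)%N]addnC addnA ps.
split=> [st|[k <-]].
  have: shift_class t t by exists 0%N.
  by rewrite -st.
have kp : (k <= k * p)%N by rewrite leq_pmulr.
apply/seteqP; split=> u [n <-]; last by exists (n + k)%N; rewrite iterD.
by exists (n + (k * p - k))%N; rewrite iterD -(iterD (_ - _)) subnK // per.
Qed.

(* Main.v *)
From HB Require Import structures.
Require Import Defs.
From mathcomp Require Import all_boot all_fingroup all_solvable all_algebra.
From mathcomp Require Import all_field qpoly qfpoly zify.
From mathcomp Require Import boolp classical_sets cardinality.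

(** Write q for the number of elements of F and M for q^N - 1.

    A sequence s extends to a linear form on F[X] sending X^i to s_i
    ([seq_form]), and f is a characteristic polynomial of s exactly when this
    form vanishes on the ideal (f). Reading N consecutive terms of s amounts to
    evaluating the form on X^i, ..., X^(i+N-1), and the powers below N = deg f
    span F[X]/(f). So if f is irreducible and s is nonzero, a polynomial d for
    which the form vanishes on d X^j for all j < N annihilates s, hence is
    divisible by f ([form_dvd]): otherwise d and f would generate the unit
    ideal. Applied to d = X^i and to d = X^k - X^i, this shows for a primitive
    f that the windows of s at positions below M are nonzero and pairwise
    distinct. There are M nonzero words, so every one of them is a window of s
    ([char_poly_punctured]); s is then called a punctured de Bruijn sequence.

    A punctured de Bruijn sequence that starts with N - 1 zeros becomes a de
    Bruijn sequence when one more zero is put in front of each period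
    ([insert_zero_de_bruijn]), since the N - 1 zeros absorb the effect of the
    insertion on the windows that straddle two periods. Any punctured sequence
    can be rotated to start that way, because the word 1 0 ... 0 occurs in it;
    this gives (i) ([punctured_modified]).

    For (ii) and (iii), a primitive polynomial f gives the impulse response
    sequence of f, which starts with N - 1 zeros, and so a de Bruijn sequence.
    Primitive polynomials of every degree exist: take the minimal polynomial of
    a generator of the cyclic group of units of an extension of F of degree N
    ([primitive_poly_exists]). In a de Bruijn sequence the zero word occurs once
    per period, which marks where the zero was inserted; so shift-equivalent
    de Bruijn sequences built in this way come from the same impulse response
    ([insert_zero_equiv]), and a nonzero sequence has at most one irreducible
    characteristic polynomial ([char_poly_eq]). *)

Set Implicit Arguments.
Unset Strict Implicit.
Unset Printing Implicit Defensive.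

Import GRing.Theory.

(** * Primitive polynomials of every degree *)

Section PrimitivePolynomials.
Local Open Scope ring_scope.

Lemma separable_XqX (L : fieldType) m : m%:R = 0 :> L -> (1 < m)%N ->
  separable_poly ('X^m - 'X : {poly L}).
Proof.
move=> m0 m_gt1; rewrite separable_poly.unlock derivB derivXn derivX -mulr_natr.
rewrite -polyC_natr m0 polyC0 mulr0 sub0r -[- 1]scaleN1r.
by rewrite coprimepZr ?oppr_eq0 ?oner_neq0 // coprimep1.
Qed.

Lemma card_finvect (F : finFieldType) (L : fieldExtType F) :
  #|finvect_type L| = (#|F| ^ \dim {:L})%N.
Proof.
etransitivity; last exact: (@card_vspace F (finvect_type L)).
by symmetry; apply: card_vspacef.
Qed.

(** The extension is a splitting field L of X^m - X, where m = q^N. The roots of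
    this separable polynomial are the fixed points of the N-th power of the
    Frobenius automorphism, so they form a subfield with m elements, which is
    all of L since they generate L. *)
Lemma finField_ext_exists (F : finFieldType) N : (0 < N)%N ->
  exists L : splittingFieldType F, \dim {:L} = N.
Proof.
move=> N_gt0; set q := #|F|; have q_gt1 : (1 < q)%N := finNzRing_gt1 F.
have m_gt1 : (1 < q ^ N)%N by rewrite (ltn_exp2l 0).
have sz (R : fieldType) : size ('X^(q ^ N) - 'X : {poly R}) = (q ^ N).+1.
  by rewrite size_polyDl size_polyXn // size_polyN size_polyX.
have nz : ('X^(q ^ N) - 'X : {poly F}) != 0 by rewrite -size_poly_gt0 sz.
have [L [zs]] := FinSplittingFieldFor nz.
rewrite rmorphB rmorphXn /= map_polyX => DqL defL; exists L.
have [alpha _ Da] := finField_galois_generator (sub1v {:L}%AS).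
have q0 : (q ^ N)%:R = 0 :> L.
  suffices q0 : q%:R = 0 :> F.
    rewrite natrX -(rmorph_nat (in_alg L)) q0 rmorph0 expr0n.
    by case: (N) N_gt0.
  by rewrite -FinRing.zmodXgE /q -cardsT expg_cardG ?inE.
have Uzs : uniq zs.
  by rewrite -separable_prod_XsubC -(eqp_separable DqL) separable_XqX.
have in_zs : zs =i fixedSpace (alpha ^+ N)%g.
  move=> z; rewrite -root_prod_XsubC -(eqp_root DqL) (sameP fixedSpaceP eqP).
  rewrite /root !hornerE subr_eq0; congr (_ == z).
  elim: (N) => [|i IHi]; first by rewrite gal_id.
  by rewrite expgSr expnSr exprM IHi galM ?memvf // Da ?memvf // dimv1 expn1.
have defE : fixedSpace (alpha ^+ N)%g = {:L}%VS.
  apply/eqP; rewrite eqEsubv subvf -defL -[fixedSpace _]subfield_closed.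
  rewrite agenvS //.
  by rewrite subv_add sub1v; apply/span_subvP=> z; rewrite in_zs.
have cL : #|finvect_type L| = (q ^ N)%N.
  suffices /eq_card-> : finvect_type L =i zs.
    apply: succn_inj; rewrite (card_uniqP _) //= -(size_prod_XsubC _ id).
    by rewrite -(eqp_size DqL) sz.
  by move=> z; rewrite in_zs defE memvf.
by apply: (expnI q_gt1); rewrite -cL card_finvect.
Qed.

(** f divides X^n - 1 if and only if x^n = 1, where x is a generator of the
    units of the extension and f its minimal polynomial; so the order of f is
    that of x. *)
Lemma primitive_poly_exists (F : finFieldType) N : (0 < N)%N ->
  exists f : {poly F}, primitive_poly f /\ size f = N.+1.
Proof.
move=> N_gt0; have [L dimL] := finField_ext_exists F N_gt0.
have cL : #|finvect_type L| = (#|F| ^ N)%N.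
  by rewrite card_finvect dimL.
have /cyclicP[u Gu] := field_unit_group_cyclic [set: {unit finvect_type L}]%G.
have ou : #[u]%g = (#|F| ^ N).-1 by rewrite orderE -Gu card_finField_unit cL.
pose x : L := FinRing.uval u.
have xX n : (x ^+ n == 1) = (#[u]%g %| n)%N.
  by rewrite order_dvdn -(inj_eq val_inj) FinRing.val_unitX.
(* Every nonzero element of L is a power of x. *)
have Lx : <<1; x>>%VS = {:L}%VS.
  apply/eqP; rewrite eqEsubv subvf; apply/subvP => y _.
  have [->|y0] := eqVneq y 0; first exact: mem0v.
  have Uy : (y : finvect_type L) \is a GRing.unit by rewrite unitfE.
  have : FinRing.unit _ Uy \in <[u]>%g by rewrite -Gu inE.
  move=> /cycleP[n] /(congr1 val) /=; rewrite FinRing.val_unitX => ->.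
  exact/rpredX/memv_adjoin.
have [f Df] := polyOver1P (minPolyOver 1 x).
have szf : size f = N.+1.
  rewrite -(size_map_poly (in_alg L)) -Df size_minPoly adjoin_degreeE Lx.
  by rewrite dimv1 divn1 dimL.
have fM : f \is monic by rewrite -(map_monic (in_alg L)) -Df monic_minPoly.
have fdvd g : (f %| g) = root (map_poly (in_alg L) g) x.
  rewrite -(dvdp_map (in_alg L)) -Df; apply/idP/idP => [/dvdpP[h ->]|gx].
    by rewrite rootM root_minPoly orbT.
  by apply: minPoly_dvdp => //; apply/polyOver1P; exists g.
have fX n : (f %| 'X^n - 1) = ((#|F| ^ N).-1 %| n)%N.
  rewrite fdvd rmorphB rmorphXn /= map_polyX rmorph1 rootE !hornerE subr_eq0.
  by rewrite xX ou.
have fI : irreducible_poly f.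
  split=> [|g g1 gf]; first by rewrite szf.
  have : map_poly (in_alg L) g %| minPoly 1 x by rewrite Df dvdp_map.
  move=> /minPoly_irr; rewrite Df eqp_map; case/(_ _)/orP => //.
    by apply/polyOver1P; exists g.
  by rewrite -(rmorph1 (map_poly (in_alg L))) eqp_map -size_poly_eq1 (negPf g1).
exists f; split=> //; apply/primitive_polyP.
rewrite card_monic_qpoly ?szf //; split=> [//||n /andP[n0 ltn]].
  by rewrite fX.
by rewrite fX; apply/negP => /dvdn_leq -/(_ n0); rewrite leqNgt ltn.
Qed.

End PrimitivePolynomials.

(** * Windows of periodic sequences *)

Lemma periodicM (T : Type) p (s : nat -> T) k i :
  periodic p s -> s (i + k * p) = s i.
Proof.
move=> [_ ps]; elim: k => [|k IH]; first by rewrite addn0.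
by rewrite mulSn addnCA addnC ps.
Qed.

Lemma periodic_modn (T : Type) p (s : nat -> T) i :
  periodic p s -> s (i %% p) = s i.
Proof. by move=> ps; rewrite {2}(divn_eq i p) addnC periodicM. Qed.

Lemma iter_shiftE (T : Type) k (s : nat -> T) i :
  iter k (@shift T) s i = s (i + k).
Proof. by elim: k i => [|k IH] i; rewrite ?addn0 //= /shift IH addSnnS. Qed.

Lemma eq_windowP (T : Type) N (s t : nat -> T) i k :
  window N s i = window N t k <->
  (forall j, (j < N) -> s (i + j) = t (k + j)).
Proof.
split=> [E j jN|E]; last by apply/eq_from_tnth => j; rewrite !tnth_mktuple E.
by have := congr1 (fun w => tnth w (Ordinal jN)) E; rewrite !tnth_mktuple.
Qed.

Lemma window_modn (T : Type) N p (s : nat -> T) i :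
  periodic p s -> window N s (i %% p) = window N s i.
Proof.
move=> ps; apply/eq_windowP => j _.
by rewrite -(periodic_modn _ ps) modnDml periodic_modn.
Qed.

Lemma periodic_rot (T : Type) p k (s : nat -> T) :
  periodic p s -> periodic p (fun i => s (i + k)).
Proof. by move=> [p0 ps]; split=> // i; rewrite addnAC ps. Qed.

(** The term k * p only keeps the subtraction from truncating. *)
Lemma window_rot (T : Type) N p k (s : nat -> T) i : periodic p s ->
  window N (fun i => s (i + k)) (i + k * p - k) = window N s i.
Proof.
move=> ps; have kp : k <= k * p by rewrite leq_pmulr ?ps.1.
apply/eq_windowP => j _.
by rewrite -[RHS](periodicM k _ ps); congr s; lia.
Qed.

Definition zero_word (F : nmodType) N : N.-tuple F := [tuple 0%R | _ < N].

Lemma window_eq0P (F : nmodType) N (s : nat -> F) i :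
  window N s i = zero_word F N <-> (forall j, (j < N) -> s (i + j) = 0%R).
Proof. exact: (@eq_windowP F N s (fun=> 0%R) i 0). Qed.

Lemma de_bruijnP (F : finFieldType) N (b : nat -> F) :
  de_bruijn N b <->
  periodic (#|F| ^ N) b /\ forall v : N.-tuple F, exists i, window N b i = v.
Proof.
split=> [[pb wb]|[pb wb]]; split=> //.
  move=> v; have : [set: N.-tuple F]%classic v by [].
  by rewrite -wb => -[i _ <-]; exists i.
apply/seteqP; split=> // v _; have [i <-] := wb v.
exists (i %% #|F| ^ N); last exact: window_modn.
by rewrite /= ltn_mod; case: pb.
Qed.

(** As many windows per period as words: since every word is a window, none
    occurs twice. *)
Lemma de_bruijn_window_inj (F : finFieldType) N (b : nat -> F) i k :
  de_bruijn N b -> window N b i = window N b k -> i = k %[mod #|F| ^ N].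
Proof.
move=> [pb wb]; set L := (#|F| ^ N) in pb wb *; have [L0 _] := pb.
pose w (a : 'I_L) := window N b a.
have winj : {in predT &, injective w}.
  apply/image_injP/eqP; rewrite [RHS]card_ord -[RHS](card_tuple N F).
  apply: eq_card => v; rewrite inE.
  have : [set: N.-tuple F]%classic v by [].
  by rewrite -wb => -[a aL <-]; apply/fintype.imageP; exists (Ordinal aL).
move=> E.
have := winj (Ordinal (ltn_pmod i L0)) (Ordinal (ltn_pmod k L0)) isT isT.
by rewrite /w /= !window_modn // => /(_ E) [].
Qed.

Lemma de_bruijn_rot (F : finFieldType) N k (b : nat -> F) :
  de_bruijn N b -> de_bruijn N (fun i => b (i + k)).
Proof.
move=> /de_bruijnP[pb wb]; apply/de_bruijnP; split; first exact: periodic_rot.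
by move=> v; have [i <-] := wb v; eexists; apply: (window_rot _ _ _ pb).
Qed.

Lemma expn_card_gt0 (F : finFieldType) N : 0 < #|F| ^ N.
Proof. by rewrite expn_gt0 (ltnW (finNzRing_gt1 F)). Qed.

Lemma leq_card_pred (F : finFieldType) N : (N <= (#|F| ^ N).-1).
Proof. by rewrite -ltnS prednK ?expn_card_gt0 // ltn_expl ?finNzRing_gt1. Qed.

(** * Inserting a zero in each period *)

(** An intrinsic form of modified_de_bruijn, in terms of the windows of s alone:
    it can be checked by counting and is invariant under rotation. *)
Definition punctured_de_bruijn (F : finFieldType) N (s : nat -> F) : Prop :=
  periodic (#|F| ^ N).-1 s /\
  forall v : N.-tuple F, v != zero_word F N -> exists i, window N s i = v.

Lemma punctured_rot (F : finFieldType) N k (s : nat -> F) :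
  punctured_de_bruijn N s -> punctured_de_bruijn N (fun i => s (i + k)).
Proof.
move=> [ps ws]; split; first exact: periodic_rot.
by move=> v /ws[i <-]; eexists; apply: (window_rot _ _ _ ps).
Qed.

Definition insert_zero (F : nmodType) M (s : nat -> F) : nat -> F :=
  fun i => if (i %% M.+1) is k.+1 then s k else 0%R.

Lemma insert_zero_periodic (F : nmodType) M (s : nat -> F) :
  periodic M.+1 (insert_zero M s).
Proof. by split=> // i; rewrite /insert_zero modnDr. Qed.

Lemma insert_zeroS (F : nmodType) M (s : nat -> F) k :
  (k < M) -> insert_zero M s k.+1 = s k.
Proof. by move=> kM; rewrite /insert_zero modn_small. Qed.

(** The N - 1 zeros at the start of s make the shift by one index persist past
    the zero inserted at index M + 1, far enough to cover every window of s
    that starts in the first period. *)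
Lemma insert_zeroS_overlap (F : nmodType) M N (s : nat -> F) k :
  periodic M s -> (N <= M) -> (forall e, (e.+1 < N) -> s e = 0%R) ->
  (k.+1 < M + N) -> insert_zero M s k.+1 = s k.
Proof.
move=> ps NM s0 kMN; have [kM|Mk] := ltnP k M; first exact: insert_zeroS.
have [_ pM] := ps.
have [e Ek] : exists e, k = e + M by exists (k - M); lia.
rewrite Ek pM s0; last by lia.
rewrite -addnS /insert_zero modnDr.
by case: e Ek => [|e] Ek; rewrite ?mod0n // modn_small ?s0 //; lia.
Qed.

Lemma insert_zero_window0 (F : nmodType) M N (s : nat -> F) : (N <= M) ->
  (forall e, (e.+1 < N) -> s e = 0%R) ->
  window N (insert_zero M s) 0 = zero_word F N.
Proof.
move=> NM s0; apply/window_eq0P => -[|j] jN; rewrite add0n.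
  by rewrite /insert_zero mod0n.
by rewrite insert_zeroS ?s0 //; lia.
Qed.

Lemma insert_zero_de_bruijn (F : finFieldType) N (s : nat -> F) :
  punctured_de_bruijn N s -> (forall e, (e.+1 < N) -> s e = 0%R) ->
  de_bruijn N (insert_zero (#|F| ^ N).-1 s).
Proof.
have NM := leq_card_pred F N; have Q0 := expn_card_gt0 F N.
move: NM; set M := _.-1 => NM [ps ws] s0; apply/de_bruijnP.
rewrite -(prednK Q0) -/M; split=> [|v]; first exact: insert_zero_periodic.
have [->|/ws[i wi]] := eqVneq v (zero_word F N).
  by exists 0; apply: insert_zero_window0.
have M0 := ps.1; exists (i %% M).+1; rewrite -wi -(window_modn _ _ ps).
have iM := ltn_pmod i M0; apply/eq_windowP => j jN.
by rewrite addSn (insert_zeroS_overlap ps NM) //; lia.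
Qed.

(** With t the position of the word 1 0 ... 0, the rotation of s that starts
    just after t begins with N - 1 zeros. A zero is inserted in front of it, and
    the result is rotated back, so that deletion of index t + 1 restores s. *)
Lemma punctured_modified (F : finFieldType) N (s : nat -> F) : (0 < N) ->
  punctured_de_bruijn N s -> modified_de_bruijn N s.
Proof.
move=> N0 ds; have [ps ws] := ds; split=> //.
have NM := leq_card_pred F N; have L0 := expn_card_gt0 F N.
have [i0 wi0] : exists i, window N s i = [tuple (j == 0 :> nat)%:R%R | j < N].
  apply: ws; apply/eqP => /(congr1 (fun w => tnth w (Ordinal N0))) /eqP.
  by rewrite !tnth_mktuple oner_eq0.
rewrite /modified_de_bruijn; set M := (#|F| ^ N).-1 in NM ps *.
have LE : #|F| ^ N = M.+1 by rewrite /M prednK.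
have M0 := ps.1; pose t := i0 %% M; have tM : t < M by rewrite ltn_mod.
pose s' i := s (i + t.+1).
have s'0 e : e.+1 < N -> s' e = 0%R.
  move=> eN; rewrite /s' -addSnnS -(periodic_modn _ ps) modnDmr.
  rewrite periodic_modn //.
  have := congr1 (fun w => tnth w (Ordinal eN)) wi0.
  by rewrite !tnth_mktuple /= addnC.
pose b i := insert_zero M s' (i + (M - t)).
have db : de_bruijn N b.
  apply: de_bruijn_rot; apply: insert_zero_de_bruijn => //.
  exact: punctured_rot.
exists b; split=> //; exists t.+1, 0; split=> //.
- by rewrite LE.
- apply/window_eq0P => j jN; have /window_eq0P := insert_zero_window0 NM s'0.
  move=> /(_ j jN) <-; rewrite /b -[RHS](insert_zero_periodic M s').2.
  by congr (insert_zero _ _ _); lia.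
rewrite addn0 modn_small; last by rewrite LE.
apply: funext => i; rewrite /delete_mod LE /=.
rewrite {1}(divn_eq i M) addnC periodicM //; have := ltn_pmod i M0.
move: (i %% M) (i %/ M) => e a eM; have [_ ps1] := ps.
rewrite addnC /b addnAC (periodicM _ _ (insert_zero_periodic M s')) /bump.
(* Up to index t, a period of s is the end of a period of the rotated sequence;
   from t + 1 on, it is the start of the next one, behind the inserted zero. *)
case: leqP => et.
  rewrite (_ : _ + _ = (e + (M - t.+1)).+1); last by lia.
  rewrite insert_zeroS /s'; last by lia.
  by rewrite -[LHS]ps1; congr s; lia.
rewrite (_ : _ + _ = (e - t.+1).+1 + M.+1); last by lia.
rewrite (insert_zero_periodic M s').2 insert_zeroS /s'; last by lia.
by congr s; lia.
Qed.

(** The zero word occurs once per period of each of the two de Bruijn sequences,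
    at index 0; so a shift that takes one to the other is by a multiple of the
    period, hence trivial. *)
Lemma insert_zero_equiv (F : finFieldType) N (s t : nat -> F) :
  let M := (#|F| ^ N).-1 in
  punctured_de_bruijn N s -> (forall e, e.+1 < N -> s e = 0%R) ->
  punctured_de_bruijn N t -> (forall e, e.+1 < N -> t e = 0%R) ->
  shift_equiv (insert_zero M s) (insert_zero M t) -> s = t.
Proof.
move=> M ds s0 dt t0 [k E].
have NM : N <= M := leq_card_pred F N.
have LE : #|F| ^ N = M.+1 by rewrite /M prednK ?expn_card_gt0.
have zk : window N (insert_zero M s) k = window N (insert_zero M s) 0.
  rewrite (insert_zero_window0 NM s0) -(insert_zero_window0 NM t0) -E.
  by apply/eq_windowP => j _; rewrite iter_shiftE addnC.
have := de_bruijn_window_inj (insert_zero_de_bruijn ds s0) zk.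
rewrite LE mod0n => k0.
have {}E : insert_zero M s = insert_zero M t.
  rewrite -E; apply: funext => i; rewrite iter_shiftE (divn_eq k M.+1) k0 addn0.
  by rewrite (periodicM _ _ (insert_zero_periodic M s)).
apply: funext => i; rewrite -(periodic_modn i ds.1) -(periodic_modn i dt.1) -/M.
have iM := ltn_pmod i ds.1.1.
by rewrite -[LHS](insert_zeroS s iM) -[RHS](insert_zeroS t iM) E.
Qed.

(** * The linear form of a linear recurring sequence *)

Section LinearForm.
Local Open Scope ring_scope.

(** The linear form that sends each X^i to s i. *)
Definition seq_form (R : comNzRingType) (s : nat -> R) (g : {poly R}) : R :=
  \sum_(j < size g) g`_j * s j.

Lemma seq_form_wide (R : comNzRingType) (s : nat -> R) n (g : {poly R}) :
  (size g <= n)%N -> seq_form s g = \sum_(j < n) g`_j * s j.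
Proof.
move=> gn; rewrite /seq_form (big_ord_widen n (fun j => g`_j * s j)) //.
rewrite big_mkcond; apply: eq_bigr => j _; case: ltnP => // gj.
by rewrite nth_default ?mul0r.
Qed.

Lemma seq_form_is_linear (R : comNzRingType) (s : nat -> R) :
  linear_for *%R (seq_form s).
Proof.
move=> a g h; pose n := maxn (size g) (size h).
have gn : (size g <= n)%N by rewrite leq_maxl.
have hn : (size h <= n)%N by rewrite leq_maxr.
have ghn : (size (a *: g + h)%R <= n)%N.
  rewrite (leq_trans (size_polyD _ _)) // geq_max hn andbT.
  exact: leq_trans (size_scale_leq _ _) gn.
rewrite !(@seq_form_wide _ s n) // mulr_sumr -big_split /=.
by apply: eq_bigr => j _; rewrite coefD coefZ mulrDl mulrA.
Qed.

HB.instance Definition _ (R : comNzRingType) (s : nat -> R) :=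
  GRing.isLinear.Build R {poly R} R *%R (seq_form s) (seq_form_is_linear s).

Lemma seq_formD (R : comNzRingType) (s : nat -> R) g h :
  seq_form s (g + h) = seq_form s g + seq_form s h.
Proof. exact: linearD. Qed.

Lemma seq_formB (R : comNzRingType) (s : nat -> R) g h :
  seq_form s (g - h) = seq_form s g - seq_form s h.
Proof. exact: linearB. Qed.

Lemma seq_formXn (R : comNzRingType) (s : nat -> R) i : seq_form s 'X^i = s i.
Proof.
rewrite /seq_form size_polyXn big_ord_recr /= big1 ?add0r => [|j _].
  by rewrite coefXn eqxx mul1r.
by rewrite coefXn ltn_eqF ?mul0r.
Qed.

Lemma seq_formM (R : comNzRingType) (s : nat -> R) (h d : {poly R}) :
  seq_form s (h * d) = \sum_(j < size h) h`_j * seq_form s ('X^j * d).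
Proof.
rewrite -{1}(coefK h) poly_def mulr_suml.
have := linear_sum (seq_form s) (index_enum 'I_(size h)) xpredT
  (fun i => h`_i *: 'X^i * d).
by move=> ->; apply: eq_bigr => i _; rewrite -scalerAl linearZ.
Qed.

Lemma seq_formMXn (R : comNzRingType) (s : nat -> R) i (g : {poly R}) :
  seq_form s ('X^i * g) = \sum_(j < size g) g`_j * s (i + j)%N.
Proof.
rewrite mulrC seq_formM; apply: eq_bigr => j _.
by rewrite -exprD seq_formXn addnC.
Qed.

Lemma char_poly_form (F : fieldType) (f : {poly F}) (s : nat -> F) h :
  char_poly_of f s -> seq_form s (h * f) = 0.
Proof.
move=> [_ fs]; rewrite seq_formM big1 // => i _.
by rewrite seq_formMXn fs mulr0.
Qed.

(** It is enough to test the multiples of d by the powers below deg f, since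
    these span a complement of (f), on which the form vanishes. If f did not
    divide d, then a Bezout relation between them would put 1 in the set of
    polynomials that annihilate s. *)
Lemma form_dvd (F : fieldType) (f d : {poly F}) (s : nat -> F) :
  irreducible_poly f -> char_poly_of f s -> (exists i, s i != 0) ->
  (forall j, (j < (size f).-1)%N -> seq_form s ('X^j * d) = 0) -> f %| d.
Proof.
move=> fI fs [i si] ds; apply: contraNT si => fd.
have f0 : f != 0 by rewrite monic_neq0 ?fs.1.
have ds_all h : seq_form s (h * d) = 0.
  rewrite (divp_eq h f) mulrDl mulrAC seq_formD (char_poly_form _ fs) add0r.
  rewrite seq_formM big1 // => j _; rewrite ds ?mulr0 //.
  apply: leq_trans (ltn_ord j) _.
  by rewrite -ltnS prednK ?size_poly_gt0 ?ltn_modp.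
have /Bezout_eq1_coprimepP[[u v] /= E] : coprimep f d.
  apply: contraNT fd => /fI.2/(_ (dvdp_gcdl f d))/eqp_dvdl <-.
  exact: dvdp_gcdr.
rewrite -(seq_formXn s i) -(mulr1 'X^i) -E mulrDr !mulrA seq_formD.
by rewrite (char_poly_form _ fs) ds_all addr0.
Qed.

Lemma char_poly_eq (F : fieldType) (f g : {poly F}) (s : nat -> F) :
  irreducible_poly f -> irreducible_poly g -> (exists i, s i != 0) ->
  char_poly_of f s -> char_poly_of g s -> f = g.
Proof.
move=> fI gI s0 fs gs; apply/eqP; rewrite -eqp_monic ?fs.1 ?gs.1 //.
apply/andP; split; [apply: (form_dvd fI fs)|apply: (form_dvd gI gs)] => // j _.
  exact: char_poly_form.
exact: char_poly_form.
Qed.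

(** * Sequences with a primitive characteristic polynomial *)

(** Two equal windows at i < k < M would make f divide X^i (X^(k-i) - 1),
    and a zero window at i would make it divide X^i. Since f is coprime to X and
    has order M, neither is possible. So the M windows in a period are distinct
    nonzero words, and these number M. *)
Lemma char_poly_punctured (F : finFieldType) N (f : {poly F}) (s : nat -> F) :
  primitive_poly f -> size f = N.+1 -> char_poly_of f s ->
  (exists i, s i != 0) -> punctured_de_bruijn N s.
Proof.
move=> /primitive_poly_order[fM fI f0 [M0 fX fmin]] szf fs s0.
move: M0 fX fmin; rewrite szf /=; set M := (_ ^ _).-1 => M0 fX fmin.
have ps : periodic M s.
  split=> // i; apply/eqP; rewrite -subr_eq0 -!(seq_formXn s) -seq_formB exprD.
  rewrite -[X in _ - X]mulr1 -mulrBr; have /dvdpP[h ->] := fX.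
  by rewrite mulrA (char_poly_form _ fs).
have fdvd d : (forall j, (j < N)%N -> seq_form s ('X^j * d) = 0) -> f %| d.
  by move=> ds; apply: (form_dvd fI fs s0); rewrite szf.
have coprime_Xn i : coprimep f 'X^i.
  by rewrite coprimep_expr // -['X]subr0 -polyC0 coprimep_XsubC /root f0.
have w0 i : window N s i != zero_word F N.
  apply/eqP => /window_eq0P wi; have : f %| 'X^i.
    by apply: fdvd => j jN; rewrite -exprD seq_formXn addnC wi.
  rewrite -['X^i]mulr1 Gauss_dvdpr // dvdp1 => /eqP f1.
  by have := fI.1; rewrite f1.
have winj i k : (i < k < M)%N -> window N s i <> window N s k.
  move=> /andP[ik kM] /eq_windowP E.
  have : f %| 'X^i * ('X^(k - i) - 1).
    apply: fdvd => j jN; rewrite mulrA mulrBr mulr1 -!exprD seq_formB.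
    rewrite !seq_formXn -addnA subnKC ?(ltnW ik) //.
    by rewrite ![(j + _)%N]addnC E ?subrr.
  rewrite Gauss_dvdpr // => /fmin; rewrite subn_gt0 => /(_ ik); lia.
split=> // v v0.
pose w (a : 'I_M) := window N s a.
have iw : injective w.
  move=> a c E; apply/val_inj; case: (ltngtP (val a) (val c)) => // ac.
    by case: (winj a c); rewrite ?ac //=.
  by case: (winj c a); rewrite ?ac //=.
have : v \in codom w.
  have cw : #|codom w| = #|[pred u : N.-tuple F | u != zero_word F N]|.
    rewrite card_codom // card_ord -[LHS]/M.
    by have := cardC1 (zero_word F N); rewrite card_tuple -/M => <-.
  have /(subset_cardP cw) -> // : codom w \subset [pred u | u != zero_word F N].
  by apply/fintype.subsetP => _ /codomP[a ->]; exact: w0.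
by move=> /codomP[a ->]; exists a.
Qed.

Lemma min_poly_neq0 (F : fieldType) (f : {poly F}) (s : nat -> F) :
  min_poly_of f s -> (1 < size f)%N -> exists i, s i != 0.
Proof.
move=> [_ smin] f1; apply: contrapT => s0.
have /smin : char_poly_of 1 s.
  split=> [|i]; first exact: monic1.
  rewrite big1 // => j _; case: (eqVneq (s (i + j)%N) 0) => [->|si].
    by rewrite mulr0.
  by case: s0; exists (i + j)%N.
by rewrite size_poly1 leqNgt f1.
Qed.

(** The solution of the recurrence of f with initial state 0, ..., 0, 1. Since
    reading off a coefficient of the remainder modulo f is a linear form that
    vanishes on (f), the recurrence holds; and the remainder of X^i is X^i
    itself for i < deg f. The coefficient read is the top one, in degree
    deg f - 1, whence the index (size f).-2. *)
Definition impulse (F : fieldType) (f : {poly F}) (i : nat) : F :=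
  ('X^i %% f)`_(size f).-2.

Lemma impulse_char (F : fieldType) (f : {poly F}) :
  f \is monic -> char_poly_of f (impulse f).
Proof.
move=> fM; split=> // i; set n := (size f).-2.
have E (c : nat -> F) (p : nat -> {poly F}) m :
    ((\sum_(j < m) c j *: p j) %% f)`_n = \sum_(j < m) c j * (p j %% f)`_n.
  elim: m => [|m IH]; first by rewrite !big_ord0 mod0p coef0.
  by rewrite !big_ord_recr /= modpD coefD IH modpZl coefZ.
rewrite -(E (fun j => f`_j) (fun j => 'X^(i + j))).
rewrite (eq_bigr (fun j : 'I_(size f) => 'X^i * (f`_j *: 'X^j))); last first.
  by move=> j _; rewrite exprD -scalerAr.
by rewrite -mulr_sumr -poly_def coefK modp_mull coef0.
Qed.

Lemma impulse_small (F : fieldType) (f : {poly F}) N i : size f = N.+1 ->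
  (i < N)%N -> impulse f i = (N.-1 == i)%:R.
Proof.
move=> szf iN; rewrite /impulse szf modp_small ?coefXn //.
by rewrite size_polyXn szf.
Qed.

Lemma impulse_start (F : fieldType) (f : {poly F}) N e : size f = N.+1 ->
  (e.+1 < N)%N -> impulse f e = 0.
Proof. by move=> szf eN; rewrite (impulse_small szf) ?gtn_eqF //; lia. Qed.

Lemma impulse_neq0 (F : fieldType) (f : {poly F}) N : (0 < N)%N ->
  size f = N.+1 -> exists i, impulse f i != 0.
Proof.
move=> N0 szf; exists N.-1.
by rewrite (impulse_small szf) ?eqxx ?oner_eq0 // ltn_predL.
Qed.

Lemma impulse_punctured (F : finFieldType) N (f : {poly F}) : (0 < N)%N ->
  primitive_poly f -> size f = N.+1 -> punctured_de_bruijn N (impulse f).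
Proof.
move=> N0 fp szf; have [fM _ _ _] := (primitive_poly_order f).1 fp.
apply: (char_poly_punctured fp szf (impulse_char fM)).
exact: impulse_neq0 szf.
Qed.

Lemma impulse_de_bruijn (F : finFieldType) N (f : {poly F}) : (0 < N)%N ->
  primitive_poly f -> size f = N.+1 ->
  de_bruijn N (insert_zero (#|F| ^ N).-1 (impulse f)).
Proof.
move=> N0 fp szf; apply: insert_zero_de_bruijn.
  exact: impulse_punctured.
by move=> e; apply: impulse_start.
Qed.

(** The shift class determines the impulse response, and this determines f,
    its only irreducible characteristic polynomial. *)
Lemma impulse_class_inj (F : finFieldType) N (f g : {poly F}) : (0 < N)%N ->
  primitive_poly f -> size f = N.+1 -> primitive_poly g -> size g = N.+1 ->
  shift_class (insert_zero (#|F| ^ N).-1 (impulse f)) =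
  shift_class (insert_zero (#|F| ^ N).-1 (impulse g)) -> f = g.
Proof.
move=> N0 fp szf gp szg /(shift_classP _ (insert_zero_periodic _ _)) E.
have [fM fI _ _] := (primitive_poly_order f).1 fp.
have [gM gI _ _] := (primitive_poly_order g).1 gp.
have {}E : impulse f = impulse g.
  apply: insert_zero_equiv E; first exact: impulse_punctured.
  - by move=> e; apply: impulse_start.
  - exact: impulse_punctured.
  - by move=> e; apply: impulse_start.
apply: (char_poly_eq fI gI (impulse_neq0 N0 szf) (impulse_char fM)).
by rewrite E; apply: impulse_char.
Qed.

End LinearForm.

Local Open Scope classical_set_scope.
Local Open Scope card_scope.

Theorem theorem7 (F : finFieldType) :
  (forall N : nat, 0 < N -> forall s : nat -> F,
     max_sequence N s -> modified_de_bruijn N s) /\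
  (forall N : nat, 0 < N -> exists b : nat -> F, de_bruijn N b) /\
  (forall N : nat, 0 < N ->
     [set f : {poly F} | primitive_poly f /\ size f = N.+1]
       #<= [set shift_class b | b in [set b : nat -> F | de_bruijn N b]]).
Proof.
split=> [N N0 s [_ [f [sf fp szf]]]|].
  apply/punctured_modified/(char_poly_punctured fp szf sf.1) => //.
  by apply: min_poly_neq0 sf _; rewrite szf.
split=> N N0.
  have [f [fp szf]] := primitive_poly_exists F N0.
  by exists (insert_zero (#|F| ^ N).-1 (impulse f)); apply: impulse_de_bruijn.
set A := [set f | _]; set B := [set _ | _ in _].
pose c (f : {poly F}) := shift_class (insert_zero (#|F| ^ N).-1 (impulse f)).
have cinj : {in A &, injective c}.
  by move=> f g /[!inE] -[fp szf] [gp szg]; apply: impulse_class_inj.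
rewrite -(card_le_eql (inj_card_eq cinj)).
apply: subset_card_le => _ [f [fp szf] <-].
exists (insert_zero (#|F| ^ N).-1 (impulse f)) => //.
exact: impulse_de_bruijn.
Qed.
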